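(* Let $n\in\mathbb{N}$ be even, $n\geq 2$. The function $u:\mathbb{R}^n\to\mathbb{R}$ given by $$u(x_1,\dots,x_n)=\frac{1}{n}\sum_{k=1}^{n}x_k,\qquad x_1,\dots,x_n\in\mathbb{R},$$ solves the system $$\sum_{k=1}^{n}\frac{\partial u}{\partial x_k}=n\frac{\partial u}{\partial x_n},\qquad \sum_{k=1}^{n}(-1)^k\frac{\partial u}{\partial x_k}=0,\qquad u(0,\dots,0)=0.$$ *)

(* Defs.v *)
From HB Require Import structures.
From mathcomp Require Import all_boot all_order all_algebra.
From mathcomp Require Import all_classical all_reals all_analysis.
Set Implicit Arguments.
Unset Strict Implicit.
Unset Printing Implicit Defensive.
Import Order.TTheory GRing.Theory Num.Theory.
Import numFieldNormedType.Exports.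
Local Open Scope ring_scope.

(* The canonical basis vector; the 0-based index k : 'I_n stands for the
   mathematical index k + 1. *)
Definition basis_vec (R : realType) (n : nat) (k : 'I_n) : 'rV[R]_n :=
  delta_mx 0 k.

(* The derivative operator is total, so existence is a separate predicate. *)
Definition has_partial (R : realType) (n : nat) (u : 'rV[R]_n -> R)
  (k : 'I_n) (x : 'rV[R]_n) : Prop := derivable u x (basis_vec R k).

Definition partial (R : realType) (n : nat) (u : 'rV[R]_n -> R)
  (k : 'I_n) (x : 'rV[R]_n) : R := 'D_(basis_vec R k) u x.

Lemma last_ord_subproof (n : nat) : (0 < n)%N -> (n.-1 < n)%N.
Proof. by rewrite ltn_predL. Qed.

Definition last_ord (n : nat) (n_gt0 : (0 < n)%N) : 'I_n :=
  Ordinal (last_ord_subproof n_gt0).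

(* The exponent k.+1 is the 1-based index of the k-th variable. *)
Definition solves_system (R : realType) (n : nat) (n_gt0 : (0 < n)%N)
  (u : 'rV[R]_n -> R) : Prop :=
  [/\ forall (k : 'I_n) (x : 'rV[R]_n), has_partial u k x,
      forall x : 'rV[R]_n,
        \sum_(k < n) partial u k x = n%:R * partial u (last_ord n_gt0) x,
      forall x : 'rV[R]_n,
        \sum_(k < n) (-1) ^+ k.+1 * partial u k x = 0
    & u 0 = 0].

Definition mean_coord (R : realType) (n : nat) (x : 'rV[R]_n) : R :=
  n%:R^-1 * \sum_(k < n) x 0 k.

(* Main.v *)
Require Import Defs.
From HB Require Import structures.
From mathcomp Require Import all_boot all_order all_algebra.
From mathcomp Require Import all_classical all_reals all_analysis.
Import Order.TTheory GRing.Theory Num.Theory.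
Import numFieldNormedType.Exports.
Local Open Scope ring_scope.

(** The mean is a linear form, so its derivative in any direction is its value
    at that direction, whatever the base point ([is_derive_linear]).  Along a
    vector of the canonical basis this value is [1 / n]
    ([mean_coord_basis_vec]).  As all partial derivatives are equal, the first
    equation reads [n * (1 / n) = n * (1 / n)], and the second one reduces to
    the cancellation of an even number of alternating signs
    ([sum_alternating_sign]). *)

(** The difference quotient of a linear form is constant: it is equal to its
    limit for every nonzero increment. *)
Lemma is_derive_linear (R : realType) (V : normedModType R)
    (f : {linear V -> R^o}) (x v : V) :
  is_derive x v (f : V -> R) (f v).
Proof.
have cvgf : ((fun h : R => h^-1 *: (f (h *: v + x) - f x)) @ 0^' --> f v)%classic.
  apply: cvg_near_cst; near=> h.
  have h0 : h != 0 by near: h; exact: nbhs_dnbhs_neq.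
  by rewrite linearP addrK scalerA mulVf ?scale1r.
by apply: DeriveDef; [apply/cvg_ex; exists (f v) | exact: cvg_lim cvgf].
Unshelve. all: by end_near. Qed.

Lemma mean_coord_is_linear (R : realType) (n : nat) :
  linear (@mean_coord R n : 'rV[R]_n -> R^o).
Proof.
move=> a x y; rewrite /mean_coord scalerAr -mulrDr; congr (_ * _).
rewrite scaler_sumr -big_split /=.
by apply: eq_bigr => k _; rewrite !mxE.
Qed.

HB.instance Definition _ (R : realType) (n : nat) :=
  GRing.isLinear.Build R 'rV[R]_n R^o _ (@mean_coord R n)
    (@mean_coord_is_linear R n).

Lemma mean_coord_basis_vec (R : realType) (n : nat) (k : 'I_n) :
  mean_coord (basis_vec R k) = n%:R^-1.
Proof.
rewrite /mean_coord (bigD1 k) //= big1 => [|i neq_ik]; rewrite /basis_vec !mxE.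
  by rewrite !eqxx addr0 mulr1.
by rewrite (negPf neq_ik) andbF.
Qed.

Lemma sum_alternating_sign (R : pzRingType) (n : nat) :
  \sum_(k < n) (-1) ^+ k.+1 = - (odd n)%:R :> R.
Proof.
elim: n => [|n IHn]; first by rewrite big_ord0 oppr0.
rewrite big_ord_recr /= IHn -signr_odd /=.
by case: (odd n); rewrite ?expr0 ?expr1 ?addNr ?oppr0 ?add0r.
Qed.

Theorem proposition4 (R : realType) (n : nat) (n_even : ~~ odd n)
    (n_ge2 : (2 <= n)%N) :
  solves_system (ltnW n_ge2) (@mean_coord R n).
Proof.
have dmean (k : 'I_n) (x : 'rV[R]_n) :
    is_derive x (basis_vec R k) (@mean_coord R n) n%:R^-1.
  by rewrite -(mean_coord_basis_vec R n k); exact: is_derive_linear.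
have partial_mean (k : 'I_n) x : partial (@mean_coord R n) k x = n%:R^-1.
  exact: (@derive_val _ _ _ _ _ _ _ (dmean k x)).
split=> [k x|x|x|].
- exact: (@ex_derive _ _ _ _ _ _ _ (dmean k x)).
- under eq_bigr do rewrite partial_mean.
  by rewrite sumr_const card_ord partial_mean mulr_natl.
- under eq_bigr do rewrite partial_mean.
  by rewrite -mulr_suml sum_alternating_sign (negPf n_even) oppr0 mul0r.
- exact: linear0.
Qed.
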